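(* Suppose $d\neq -3$ is a fundamental discriminant. Then for every $X>0$ $$N(d,X)=\begin{cases}M_3^{-3d}(X)&\text{if }3\nmid d,\\ M_3^{-3d}(X)+M_3^{-d/3}(X)&\text{if }3\mid d.\end{cases}$$
   Context: The quadratic resolvent field of a cubic field $K$ is $\mathbb{Q}(\sqrt{\mathrm{Disc}(K)})$. $N(d,X)$ is the number of isomorphism classes of cubic fields with absolute discriminant less than $X$ and quadratic resolvent field $\mathbb{Q}(\sqrt d)$. The value $d=1$ is allowed (it counts as a fundamental discriminant): it corresponds to Galois cubic fields, with resolvent $\mathbb{Q}$. For a cubic field $K$ with ring of integers $R$, the form $z\mapsto\mathrm{Tr}(z^2)$ on the rank-2 lattice of trace-zero elements of $\mathbb{Z}+3R$ is, in a choice of basis, $nQ(x,y)$ with $n$ a positive integer and $Q=rx^2+sxy+ty^2$ a primitive integral binary quadratic form ($\gcd(r,s,t)=1$). The shape of $K$ (or of $R$) is the $\mathrm{GL}_2(\mathbb{Z})$-equivalence class of $Q$, and the discriminant of the shape is $s^2-4rt$. $M_3^D(X)$ is the number of isomorphism classes of cubic fields $K$ whose ring of integers has shape of discriminant $D$ and with $|\mathrm{Disc}(K)|<X$. *)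

(* Defs.v *)
From HB Require Import structures.
From mathcomp Require Import all_boot all_order all_algebra all_field.
From mathcomp Require Import all_classical all_reals.

Set Implicit Arguments.
Unset Strict Implicit.
Unset Printing Implicit Defensive.

Import Order.TTheory GRing.Theory Num.Theory.

Local Open Scope classical_set_scope.
Local Open Scope ring_scope.

Definition squarefree (m : int) : Prop :=
  forall k : nat, (k ^ 2 %| `|m|)%N -> k = 1%N.

(* The value d = 1 satisfies the first clause. *)
Definition fundamental_discriminant (d : int) : Prop :=
  ((d = 1 %[mod 4])%Z /\ squarefree d) \/
  (exists m : int,
     [/\ d = 4 * m, (m = 2 %[mod 4])%Z \/ (m = 3 %[mod 4])%Z & squarefree m]).

(* Q(sqrt a) inside algC. Quadratic fields are Galois over Q, so two of them
   are isomorphic if and only if they are equal as subsets of algC. *)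
Definition quadratic_field (a : int) : set algC :=
  [set z | exists x y : rat, z = ratr x + ratr y * sqrtC a%:~R].

Definition is_cubic (K : fieldExtType rat) : Prop := \dim {:K} = 3%N.

(* Ring morphisms between extensions of Q are automatically Q-linear. *)
Definition field_iso (K L : fieldExtType rat) : Prop :=
  exists f : {rmorphism K -> L}, bijective f.

(* The types fieldExtType rat form a universe too large for the sets and the
   cardinals of the library, hence an explicit system of representatives. *)
Definition has_iso_classes (P : fieldExtType rat -> Prop) (n : nat) : Prop :=
  exists F : 'I_n -> fieldExtType rat,
    [/\ forall i, P (F i),
        forall i j, field_iso (F i) (F j) -> i = j &
        forall K, P K -> exists i, field_iso K (F i)].

(* The number of isomorphism classes of the fields satisfying P, which is +oo
   if there are infinitely many classes. *)
Definition iso_class_count (R : realType) (P : fieldExtType rat -> Prop) :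
    \bar R :=
  if pselect (exists n, has_iso_classes P n) is left h
  then (sval (cid h))%:R%:E else +oo%E.

Section NumberField.
Variable K : fieldExtType rat.

Definition field_trace (z : K) : rat :=
  \tr (passmx.mxof (vbasis {:K}) (vbasis {:K}) (amull z)).

Definition ring_of_integers : set K :=
  [set z | integralOver (intr : int -> K) z].

(* The vectors of e are linearly independent over Q, equivalently over Z. *)
Definition is_Zbasis (n : nat) (M : set K) (e : n.-tuple K) : Prop :=
  free e /\
  M = [set z | exists c : 'I_n -> int, z = \sum_(i < n) tnth e i *~ c i].

Definition is_disc (D : int) : Prop :=
  exists e : (\dim {:K}).-tuple K,
    is_Zbasis ring_of_integers e /\
    \det (\matrix_(i, j) field_trace (tnth e i * tnth e j)) = D%:~R.

(* The trace-zero elements of Z + 3 R, with R the ring of integers. *)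
Definition shape_lattice : set K :=
  [set z | field_trace z = 0 /\
           exists a : int, exists2 u, ring_of_integers u & z = a%:~R + 3 * u].

End NumberField.

Arguments is_disc : clear implicits.
Arguments shape_lattice : clear implicits.

(* (r, s, t) stands for r x^2 + s x y + t y^2. *)
Definition bqf : Type := (int * int * int)%type.

Definition bqf_eval (Q : bqf) (x y : int) : int :=
  let: (r, s, t) := Q in r * x ^+ 2 + s * x * y + t * y ^+ 2.

Definition bqf_disc (Q : bqf) : int :=
  let: (r, s, t) := Q in s ^+ 2 - 4 * r * t.

Definition bqf_primitive (Q : bqf) : Prop :=
  let: (r, s, t) := Q in gcdz (gcdz r s) t = 1.

Definition GL2Z_equiv (Q Q' : bqf) : Prop :=
  exists2 g : 'M[int]_2, g \in unitmx &
    forall x y : int,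
      bqf_eval Q' x y =
      bqf_eval Q (g 0 0 * x + g 0 1 * y) (g 1 0 * x + g 1 1 * y).

Definition is_shape_form (K : fieldExtType rat) (Q : bqf) : Prop :=
  bqf_primitive Q /\
  exists (e : 2.-tuple K) (n : int),
    [/\ is_Zbasis (shape_lattice K) e, 0 < n &
        forall x y : int,
          field_trace ((tnth e 0 *~ x + tnth e 1 *~ y) ^+ 2) =
          (n * bqf_eval Q x y)%:~R].

Definition shape (K : fieldExtType rat) : set bqf :=
  [set Q | exists2 Q0, is_shape_form K Q0 & GL2Z_equiv Q0 Q].

Definition abs_disc_lt (R : realType) (X : R) (K : fieldExtType rat) : Prop :=
  exists2 D : int, is_disc K D & `|D|%:~R < X.

Definition has_resolvent (d : int) (K : fieldExtType rat) : Prop :=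
  exists2 D : int, is_disc K D & quadratic_field D = quadratic_field d.

(* The discriminant is constant on the classes of GL2Z_equiv. *)
Definition has_shape_of_disc (D : int) (K : fieldExtType rat) : Prop :=
  exists2 Q, shape K Q & bqf_disc Q = D.

Definition N_resolvent (R : realType) (d : int) (X : R) : \bar R :=
  iso_class_count R
    (fun K => [/\ is_cubic K, abs_disc_lt X K & has_resolvent d K]).

Definition M3_shape (R : realType) (D : int) (X : R) : \bar R :=
  iso_class_count R
    (fun K => [/\ is_cubic K, has_shape_of_disc D K & abs_disc_lt X K]).

(* Main.v *)
(** Let R be the ring of integers of a cubic field K of discriminant D.  Writing
    the multiplication of R in a basis 1, w, t with w t rational (Delone and
    Faddeev), the map u |-> 3 u - Tr u sends w, t to a basis of the shape
    lattice, on which Tr(z^2) is 6 times the Hessian H of the index form, and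
    disc H = -3 D.  If H = m Q with Q primitive, then disc Q = -3 D / m^2, so
    Q(sqrt D) = Q(sqrt d) means that -3 d disc Q is a square, that is,
    disc Q = d' g^2 with d' the discriminant of Q(sqrt (-3 d)) and g an integer.
    The coefficients of the index form satisfy linear syzygies with
    coefficients in Q, from which a square factor of disc Q at a prime p <> 3,
    or a factor 27 at p = 3, would make t / p integral after a change of basis,
    contradicting the maximality of R.  So g = 1, or g = 1, 3 when 3 | d.  The
    discriminant of the shape is unique, hence the two cases for 3 | d are
    disjoint, and the count does not need to be known to be finite. *)

From HB Require Import structures.
Require Import Defs.
From mathcomp Require Import all_boot all_order all_algebra all_field.
From mathcomp Require Import ring zify.
From mathcomp Require Import all_classical all_reals.

Set Implicit Arguments.
Unset Strict Implicit.
Unset Printing Implicit Defensive.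

Import Order.TTheory GRing.Theory Num.Theory.

Local Open Scope ring_scope.

(** * Traces and Z-bases *)

Section Trace.
Variable K : fieldExtType rat.

(** Any basis computes the trace: the identity is inserted as a change-of-basis matrix, and
    cyclicity of the matrix trace moves it to the other side. *)
Lemma field_traceE n (e : n.-tuple K) z : basis_of {:K} e ->
  field_trace z = \sum_(i < n) coord e i (z * e`_i).
Proof.
move=> eB; have vB := vbasisP {:K}.
have en : n = \dim {:K} by rewrite -(size_basis eB).
subst n; have -> : field_trace z = \tr (passmx.mxof e e (amull z)).
  rewrite /field_trace -[X in passmx.mxof _ _ X]comp_lfun1r.
  rewrite (passmx.mxof_comp _ _ eB) mxtrace_mulC.
  by rewrite -(passmx.mxof_comp _ _ vB) comp_lfun1l.
apply: eq_bigr => i _.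
by rewrite mxE /= mxE passmx.vecof_delta lfunE.
Qed.

Lemma field_trace_is_scalar : scalar (@field_trace K).
Proof.
move=> a u v; rewrite !(field_traceE _ (vbasisP {:K})) mulr_sumr -big_split.
by apply: eq_bigr => i _; rewrite mulrDl -scalerAl linearP.
Qed.

HB.instance Definition _ := GRing.isSemilinear.Build rat K rat *%R (@field_trace K)
  (GRing.semilinear_linear field_trace_is_scalar).

Lemma free_basis_full n (e : n.-tuple K) : n = \dim {:K} -> free e ->
  basis_of {:K} e.
Proof. by move=> en ef; rewrite basisEfree ef subvf size_tuple en /=. Qed.

Lemma trace_mulmx n (e : n.-tuple K) z (M : 'M[rat]_n) :
  n = \dim {:K} -> free e ->
  (forall i, z * tnth e i = \sum_j M i j *: tnth e j) -> field_trace z = \tr M.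
Proof.
move=> en ef zM; rewrite (field_traceE _ (free_basis_full en ef)).
apply: eq_bigr => i _; rewrite -tnth_nth zM.
by under eq_bigr do rewrite (tnth_nth 0); rewrite coord_sum_free.
Qed.

Lemma field_trace1 : field_trace (1 : K) = (\dim {:K})%:R.
Proof.
have vB := vbasisP {:K}.
rewrite (@trace_mulmx _ (vbasis {:K}) 1 1%:M) ?mxtrace1 ?(basis_free vB) //.
move=> i; rewrite mul1r (bigD1 i) //= mxE eqxx scale1r big1 ?addr0 // => j.
by rewrite mxE eq_sym => /negPf->; rewrite scale0r.
Qed.

Definition gram n (e : n.-tuple K) : 'M[rat]_n :=
  \matrix_(i, j) field_trace (tnth e i * tnth e j).

(** A kernel vector of the Gram matrix gives a nonzero [z] with Tr(z x) = 0 for all x. Taking x =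
    1/z gives Tr 1 = 0, whereas Tr 1 is the degree. *)
Lemma gram_det_neq0 n (e : n.-tuple K) : n = \dim {:K} -> free e ->
  \det (gram e) != 0.
Proof.
move=> en ef; apply/det0P => -[v v0 vG].
have eB := free_basis_full en ef.
pose z := \sum_i v 0 i *: tnth e i.
have z0 : z != 0.
  apply: contraNneq v0 => z0; apply/eqP/rowP => i; rewrite mxE.
  rewrite -(coord_sum_free (fun i => v 0 i) i ef).
  by under eq_bigr do rewrite -tnth_nth; rewrite -/z z0 linear0.
have ze j : field_trace (z * tnth e j) = 0.
  have /rowP/(_ j) := vG; rewrite !mxE => <-.
  rewrite mulr_suml linear_sum; apply: eq_bigr => i _.
  by rewrite -scalerAl linearZ mxE.
have : field_trace (z * z^-1) = 0.
  rewrite (coord_basis eB (memvf z^-1)) mulr_sumr linear_sum big1 // => i _.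
  by rewrite -scalerAr linearZ /= -tnth_nth ze mulr0.
rewrite divff // field_trace1 => /eqP; rewrite pnatr_eq0 => /eqP dK.
by move: (adim_gt0 {:K}%AS); rewrite dK.
Qed.

Lemma Zbasis_change n (M : set K) (e e' : n.-tuple K) :
  is_Zbasis M e -> is_Zbasis M e' ->
  exists U : 'M[int]_n, forall j, tnth e' j = \sum_i tnth e i *~ U j i.
Proof.
move=> [_ Me] [_ Me'].
have He' j : exists c : 'I_n -> int, tnth e' j = \sum_(i < n) tnth e i *~ c i.
  suff : M (tnth e' j) by rewrite Me.
  rewrite Me'; exists (fun i => (i == j)%:Z).
  rewrite (bigD1 j) //= eqxx mulr1z big1 ?addr0 // => i /negPf ->.
  by rewrite mulr0z.
exists (\matrix_(j, i) sval (cid (He' j)) i) => j.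
by rewrite {1}(svalP (cid (He' j))); apply: eq_bigr => i _; rewrite mxE.
Qed.

Lemma gram_change n (e e' : n.-tuple K) (U : 'M[int]_n) :
  (forall j, tnth e' j = \sum_i tnth e i *~ U j i) ->
  \det (gram e') = (\det U)%:~R ^+ 2 * \det (gram e).
Proof.
move=> eU.
have -> : gram e' = map_mx intr U *m gram e *m (map_mx intr U)^T.
  apply/matrixP => i j; rewrite !mxE !eU mulr_suml linear_sum.
  rewrite [RHS](eq_bigr (fun k => \sum_l field_trace
     (tnth e l * tnth e k) *~ U i l *~ U j k)); last first.
    move=> k _; rewrite !mxE mulr_suml; apply: eq_bigr => l _.
    by rewrite !mxE -[RHS]mulrzr -[X in _ = X * _]mulrzl.
  rewrite [RHS]exchange_big; apply: eq_bigr => l _.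
  rewrite mulr_sumr linear_sum /=; apply: eq_bigr => k _.
  by rewrite mulrzAl mulrzAr mulrzAC !raddfMz.
by rewrite !det_mulmx det_tr det_map_mx expr2 mulrAC.
Qed.

End Trace.

(** * Unimodular changes of basis; bases of two and three elements *)

Section Zbasis.
Variable K : fieldExtType rat.
Implicit Types (M : set K) (x y z u : K).

Lemma free_span_sub n (e e' : n.-tuple K) :
  free e -> (<<e>> <= <<e'>>)%VS -> free e'.
Proof.
rewrite /free !size_tuple => /eqP en /dimvS; rewrite en => le_n.
by rewrite eqn_leq le_n andbT -[leqRHS](size_tuple e') dim_span.
Qed.

Lemma Zbasis_unimodular n M (e e' : n.-tuple K) (U : 'M[int]_n) :
  is_Zbasis M e -> U \in unitmx ->
  (forall j, tnth e' j = \sum_i tnth e i *~ U j i) -> is_Zbasis M e'.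
Proof.
move=> [ef Me] Uu eU.
have IU i k : \sum_j invmx U i j * U j k = (i == k)%:R.
  by have /matrixP/(_ i k) := mulVmx Uu; rewrite !mxE.
have eV i : tnth e i = \sum_j tnth e' j *~ invmx U i j.
  rewrite (eq_bigr (fun j => \sum_k tnth e k *~ (invmx U i j * U j k))); last first.
    move=> j _; rewrite eU mulrz_suml; apply: eq_bigr => k _.
    by rewrite mulrzA_C.
  rewrite exchange_big /= (bigD1 i) //= -mulrz_sumr IU eqxx mulr1z.
  rewrite big1 ?addr0 // => k ki.
  by rewrite -mulrz_sumr IU eq_sym (negPf ki) mulr0z.
split.
  apply: free_span_sub ef _; apply/span_subvP => _ /tnthP[i ->].
  rewrite eV; apply: memv_suml => j _; rewrite -scaler_int.
  by rewrite memvZ // memv_span // mem_tnth.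
rewrite Me; apply/seteqP; split => z [c ->] /=.
  exists (fun j => \sum_i c i * invmx U i j).
  under eq_bigr do rewrite eV mulrz_suml.
  rewrite exchange_big; apply: eq_bigr => j _ /=.
  rewrite mulrz_sumr; apply: eq_bigr => i _.
  by rewrite mulrzA_C.
exists (fun i => \sum_j c j * U j i).
under eq_bigr do rewrite eU mulrz_suml.
rewrite exchange_big; apply: eq_bigr => j _ /=.
rewrite mulrz_sumr; apply: eq_bigr => i _.
by rewrite mulrzA_C.
Qed.

Lemma free3P x y z :
  free [:: x; y; z] <->
  (forall i j k : rat, i *: x + j *: y + k *: z = 0 -> [/\ i = 0, j = 0 & k = 0]).
Proof.
split=> [/(@freeP _ _ 3 [tuple x; y; z]) fr i j k h | h].
  have := fr (fun l => nth 0 [:: i; j; k] l).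
  rewrite !big_ord_recl big_ord0 /= addr0 addrA => /(_ h) h0.
  by split; [have := h0 0 | have := h0 1 | have := h0 (inord 2)];
    rewrite ?inordK.
apply/(@freeP _ _ 3 [tuple x; y; z]) => f.
rewrite !big_ord_recl big_ord0 /= addr0 addrA => /h[h0 h1 h2].
case=> [[|[|[|//]]] i3]; [rewrite -[RHS]h0|rewrite -[RHS]h1|rewrite -[RHS]h2];
  congr f; exact: val_inj.
Qed.

Lemma free2P x y :
  free [:: x; y] <->
  (forall i j : rat, i *: x + j *: y = 0 -> i = 0 /\ j = 0).
Proof.
split=> [/(@freeP _ _ 2 [tuple x; y]) fr i j h | h].
  have := fr (fun l => nth 0 [:: i; j] l).
  rewrite !big_ord_recl big_ord0 /= addr0 => /(_ h) h0.
  by split; [have := h0 0 | have := h0 1].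
apply/(@freeP _ _ 2 [tuple x; y]) => f.
rewrite !big_ord_recl big_ord0 /= addr0 => /h[h0 h1].
case=> [[|[|//]] i2]; [rewrite -[RHS]h0|rewrite -[RHS]h1];
  congr f; exact: val_inj.
Qed.

Lemma Zbasis3P M x y z :
  is_Zbasis M [tuple x; y; z] <->
  free [:: x; y; z] /\
  (forall u, M u <-> exists i j k : int, u = x *~ i + y *~ j + z *~ k).
Proof.
split=> [[fr ->] | [fr Mu]]; split=> //.
  move=> u; split=> [[c ->]|[i [j [k ->]]]].
    by exists (c 0), (c (lift 0 0)), (c (lift 0 (lift 0 0)));
      rewrite !big_ord_recl big_ord0 addr0 addrA.
  exists (fun l => nth 0 [:: i; j; k] l).
  by rewrite !big_ord_recl big_ord0 addr0 addrA.
apply/seteqP; split=> u.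
  move=> /Mu[i [j [k ->]]]; exists (fun l => nth 0 [:: i; j; k] l).
  by rewrite !big_ord_recl big_ord0 addr0 addrA.
move=> [c ->]; apply/Mu.
by exists (c 0), (c (lift 0 0)), (c (lift 0 (lift 0 0)));
  rewrite !big_ord_recl big_ord0 addr0 addrA.
Qed.

Lemma Zbasis2P M x y :
  is_Zbasis M [tuple x; y] <->
  free [:: x; y] /\ (forall u, M u <-> exists i j : int, u = x *~ i + y *~ j).
Proof.
split=> [[fr ->] | [fr Mu]]; split=> //.
  move=> u; split=> [[c ->]|[i [j ->]]].
    by exists (c 0), (c (lift 0 0)); rewrite !big_ord_recl big_ord0 addr0.
  exists (fun l => nth 0 [:: i; j] l).
  by rewrite !big_ord_recl big_ord0 addr0.
apply/seteqP; split=> u.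
  move=> /Mu[i [j ->]]; exists (fun l => nth 0 [:: i; j] l).
  by rewrite !big_ord_recl big_ord0 addr0.
move=> [c ->]; apply/Mu.
by exists (c 0), (c (lift 0 0)); rewrite !big_ord_recl big_ord0 addr0.
Qed.

Lemma Zbasis3_indep M x y z (i j k : int) :
  is_Zbasis M [tuple x; y; z] -> x *~ i + y *~ j + z *~ k = 0 ->
  [/\ i = 0, j = 0 & k = 0].
Proof.
move=> /Zbasis3P[/free3P fr _]; rewrite -!scaler_int => /fr.
by case=> /eqP+ /eqP+ /eqP; rewrite !intr_eq0 => /eqP-> /eqP-> /eqP->.
Qed.

End Zbasis.

(** * A basis of the ring of integers containing 1 *)

Section Integers.
Variable K : fieldExtType rat.

Lemma roi_mul (x y : K) : ring_of_integers x -> ring_of_integers y ->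
  ring_of_integers (x * y).
Proof. exact: integral_mul. Qed.

Lemma roi1 : ring_of_integers (1 : K).
Proof. exact: integral1. Qed.

(** Smith normal form of the coordinate row of 1 gives a basis whose first vector [u] satisfies 1 =
    q u. Since u^2 is again integral, u = q u^2 forces q to be a unit. *)
Lemma Zbasis_with_1 (e : 3.-tuple K) : is_Zbasis (@ring_of_integers K) e ->
  exists u v, is_Zbasis (@ring_of_integers K) [tuple 1; u; v].
Proof.
move=> eB; have [c c1] : exists c : 'I_3 -> int, 1 = \sum_i tnth e i *~ c i.
  by have := roi1; rewrite eB.2.
have [L Lu [R Ru [d _ cE]]] := int_Smith_normal_form (\row_i c i).
pose f := [tuple \sum_i tnth e i *~ R j i | j < 3].
have fB : is_Zbasis (@ring_of_integers K) f.
  by apply: Zbasis_unimodular eB Ru _ => j; rewrite tnth_mktuple.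
have f1 : 1 = tnth f 0 *~ (L 0 0 * d`_0).
  rewrite tnth_mktuple mulrz_suml {1}c1; apply: eq_bigr => i _.
  rewrite -mulrzA mulrC; congr (_ *~ _).
  have /rowP/(_ i) := cE; rewrite !mxE => ->.
  rewrite (bigD1 0) //= big1 ?addr0 => [|[[|j] j3] //= _].
    by rewrite mxE big_ord1 mxE mulr1n.
  by rewrite mxE big_ord1 mxE /= mulr0n mulr0 mul0r.
move: fB f1; set q := _ * _; case/tupleP: f => u f; case/tupleP: f => v f.
case/tupleP: f => w f; rewrite (tuple0 f) {f} => fB f1.
have {}fB : is_Zbasis (@ring_of_integers K) [tuple u; v; w].
  by move: fB; congr is_Zbasis; apply: val_inj.
rewrite (tnth_nth 0) /= in f1.
have /Zbasis3P[fr mem] := fB.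
have uu : ring_of_integers (u * u).
  by apply: roi_mul; apply/mem; exists 1, 0, 0; rewrite !mulr0z !addr0.
have /mem[i [j [k uuE]]] := uu.
(* These are the coordinates of q u^2 - u = 0; the first one says q i = 1. *)
have : u *~ (q * i - 1) + v *~ (q * j) + w *~ (q * k) = 0.
  rewrite mulrzBr mulr1z -{2}[u]mulr1 f1 mulrzAr uuE !mulrzDl -!mulrzA.
  by rewrite ![q * _]mulrC; ring.
move=> /(Zbasis3_indep fB)[qi _ _].
have {i j k uuE qi} q2 : q * q = 1.
  have {}qi : q * i = 1 by lia.
  have : (`|q| * `|i| = 1)%N by rewrite -abszM qi.
  by move=> /eqP; rewrite muln_eq1 => /andP[/eqP q1 _]; lia.
have uE : u = 1 *~ q by rewrite f1 -mulrzA q2.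
exists v, w; apply/Zbasis3P; split.
  apply/free3P => i j k h.
  have [] := (free3P u v w).1 fr (i * q%:~R) j k.
    rewrite uE -scaler_int scalerA -mulrA -intrM q2 mulr1 //.
  move=> /eqP; rewrite mulf_eq0 intr_eq0 => /orP[/eqP->//|/eqP q0].
  by rewrite q0 in q2.
move=> z; split=> [/mem|] [i [j [k ->]]]; last apply/mem.
  by exists (q * i), j, k; rewrite uE mulrzA.
by exists (q * i), j, k; rewrite uE -mulrzA mulrA q2 mul1r.
Qed.

End Integers.

(** * Normal bases of cubic rings *)

(* The index form of the basis is a x^3 - b x^2 y + c x y^2 - d y^3. *)
Record cubic_basis (K : fieldExtType rat) (a b c d : int) (w t : K) : Prop :=
  CubicBasis {
    cubic_Zbasis : is_Zbasis (@ring_of_integers K) [tuple 1; w; t];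
    cubic_ww : w * w = b%:~R * w + a%:~R * t - (a * c)%:~R;
    cubic_wt : w * t = (a * d)%:~R;
    cubic_tt : t * t = d%:~R * w + c%:~R * t - (b * d)%:~R }.

Section CubicBasis.
Variable K : fieldExtType rat.
Implicit Types (w t z : K).

Lemma scale_in_alg (x : rat) z : x *: z = in_alg K x * z.
Proof. by rewrite mulr_algl. Qed.

Lemma Zbasis1P w t : is_Zbasis (@ring_of_integers K) [tuple 1; w; t] <->
  free [:: 1; w; t] /\ (forall z, ring_of_integers z <->
    exists i j k : int, z = i%:~R + j%:~R * w + k%:~R * t).
Proof.
rewrite Zbasis3P; split=> -[fr mem]; split=> // z; rewrite mem;
  by split=> -[i [j [k ->]]]; exists i, j, k; rewrite !mulrzl.
Qed.

Lemma Zbasis1_indep w t (i j k : int) :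
  is_Zbasis (@ring_of_integers K) [tuple 1; w; t] ->
  i%:~R + j%:~R * w + k%:~R * t = 0 -> [/\ i = 0, j = 0 & k = 0].
Proof. by move=> B; rewrite !mulrzl => /(Zbasis3_indep B). Qed.

Lemma Zbasis1_inj w t (i j k i' j' k' : int) :
  is_Zbasis (@ring_of_integers K) [tuple 1; w; t] ->
  i%:~R + j%:~R * w + k%:~R * t = i'%:~R + j'%:~R * w + k'%:~R * t ->
  [/\ i = i', j = j' & k = k'].
Proof.
move=> B h.
have [] := @Zbasis1_indep w t (i - i') (j - j') (k - k') B.
  by rewrite !intrB; apply/eqP; move/eqP: h; rewrite -subr_eq0; congr (_ == _); ring.
by move=> *; split; lia.
Qed.

(** For [k = 0] this translates both generators by integers, which makes their product rational; for
    general [k] it is the shear that adapts the Hessian to a prime. *)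
Lemma Zbasis1_shear w t (k m n : int) :
  is_Zbasis (@ring_of_integers K) [tuple 1; w; t] ->
  is_Zbasis (@ring_of_integers K)
    [tuple 1; w - m%:~R; t + k%:~R * w - n%:~R].
Proof.
move=> B; have /Zbasis1P[fr mem] := B; apply/Zbasis1P; split.
  apply/free3P => x y z.
  move=> h; have [] := (free3P 1 w t).1 fr (x - y * m%:~R - z * n%:~R)
    (y + z * k%:~R) z.
    move: h; rewrite !scale_in_alg => h.
    by rewrite -h !(rmorphB, rmorphD, rmorphM) !rmorph_int; ring.
  by move=> x0 y0 z0; move: x0 y0; rewrite z0 !mul0r addr0 subr0 => + y0;
    rewrite y0 mul0r subr0.
move=> z; rewrite mem; split=> -[x [y [u ->]]].
  exists (x + y * m + u * n - u * k * m), (y - u * k), u.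
  by rewrite !(intrD, intrM, intrN); ring.
exists (x - y * m - u * n), (y + u * k), u.
by rewrite !(intrD, intrM, intrN); ring.
Qed.

Lemma Zbasis1_swap w t :
  is_Zbasis (@ring_of_integers K) [tuple 1; w; t] ->
  is_Zbasis (@ring_of_integers K) [tuple 1; t; w].
Proof.
move=> B; have /Zbasis1P[/free3P fr mem] := B; apply/Zbasis1P; split.
  by apply/free3P => x y z; rewrite addrAC => /fr[].
by move=> z; rewrite mem; split=> -[x [y [u ->]]]; exists x, u, y; rewrite addrAC.
Qed.

(** Integer translations of the two generators make their product an integer. Associativity then
    determines every constant term of the multiplication table, so that four integers remain. *)
Lemma cubic_basis_exists : is_cubic K -> forall e : (\dim {:K}).-tuple K,
  is_Zbasis (@ring_of_integers K) e ->
  exists a b c d w t, @cubic_basis K a b c d w t.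
Proof.
rewrite /is_cubic => ->; move=> e /Zbasis_with_1[u [v B]].
have /Zbasis1P[_ mem] := B.
have uR : ring_of_integers u by apply/mem; exists 0, 1, 0; rewrite !mul0r mul1r; ring.
have vR : ring_of_integers v by apply/mem; exists 0, 0, 1; rewrite !mul0r mul1r; ring.
(* The translations absorb the terms [i u] and [j v] of u v; the zero multiple of [u] in [t] only
   matches the form of [Zbasis1_shear]. *)
have /mem[m [i [j uvE]]] := roi_mul uR vR.
pose w := u - j%:~R; pose t := v + 0%:~R * u - i%:~R.
have B' : is_Zbasis (@ring_of_integers K) [tuple 1; w; t].
  exact: Zbasis1_shear.
have /Zbasis1P[_ mem'] := B'.
pose n := m + i * j.
have wt : w * t = n%:~R.
  by rewrite /w /t /n intrD intrM mul0r addr0 mulrBl mulrBr uvE; ring.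
have wR : ring_of_integers w by apply/mem'; exists 0, 1, 0; rewrite !mul0r mul1r; ring.
have tR : ring_of_integers t by apply/mem'; exists 0, 0, 1; rewrite !mul0r mul1r; ring.
have /mem'[A0 [A1 [A2 ww]]] := roi_mul wR wR.
have /mem'[B0 [B1 [B2 tt]]] := roi_mul tR tR.
(* Comparing coordinates in (w w) t = w (w t) gives n = A2 B1 and A0 = - A2 B2. *)
have := @Zbasis1_inj w t (A1 * n + A2 * B0) (A2 * B1) (A0 + A2 * B2) 0 n 0 B'.
case.
  transitivity (w * w * t); last by rewrite -mulrA wt; ring.
  transitivity (A0%:~R * t + A1%:~R * (w * t) + A2%:~R * (t * t)).
    by rewrite wt tt !(intrD, intrM); ring.
  by rewrite ww; ring.
move=> _ nE A0E.
(* Comparing coordinates in w (t t) = (w t) t gives B0 = - A1 B1. *)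
have := @Zbasis1_inj w t (B1 * A0 + B2 * n) (B0 + B1 * A1) (B1 * A2) 0 0 n B'.
case.
  transitivity (w * (t * t)); last by rewrite mulrA wt; ring.
  transitivity (B0%:~R * w + B1%:~R * (w * w) + B2%:~R * (w * t)).
    by rewrite wt ww !(intrD, intrM); ring.
  by rewrite tt; ring.
move=> _ B0E _.
exists A2, A1, B2, B1, w, t; split=> //.
- rewrite ww (_ : A0 = - (A2 * B2)); last by lia.
  by rewrite intrN; ring.
- by rewrite wt nE.
- rewrite tt (_ : B0 = - (A1 * B1)); last by lia.
  by rewrite intrN; ring.
Qed.

Lemma cubic_basis_swap a b c d w t :
  cubic_basis a b c d w t -> cubic_basis d c b a t w.
Proof.
case=> B ww wt tt; split; first exact: Zbasis1_swap.
- by rewrite tt mulrC [d * b]mulrC; ring.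
- by rewrite mulrC wt mulrC.
- by rewrite ww [c * a]mulrC; ring.
Qed.

(** The index form undergoes the substitution x -> x + k y. The integers subtracted from w and t + k
    w are those that keep their product rational. *)
Lemma cubic_basis_shear a b c d w t k : cubic_basis a b c d w t ->
  cubic_basis a (b - 3 * a * k) (c - 2 * b * k + 3 * a * k ^+ 2)
    (d - c * k + b * k ^+ 2 - a * k ^+ 3)
    (w - (k * a)%:~R) (t + k%:~R * w - (k * b - k ^+ 2 * a)%:~R).
Proof.
case=> B ww wt tt; split; first exact: Zbasis1_shear.
- transitivity (w * w - (2 * k * a)%:~R * w + (k * a * k * a)%:~R).
    by rewrite !(intrD, intrM, intrN); ring.
  by rewrite ww !(intrD, intrM, intrN); ring.
- transitivity (w * t + k%:~R * (w * w) - (k * b - k ^+ 2 * a)%:~R * w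
    - (k * a)%:~R * (t + k%:~R * w) + (k * a * (k * b - k ^+ 2 * a))%:~R).
    by rewrite !(intrD, intrM, intrN); ring.
  by rewrite ww wt !(intrD, intrM, intrN); ring.
- transitivity (t * t + 2 * k%:~R * (w * t) + k%:~R ^+ 2 * (w * w)
    - 2 * (k * b - k ^+ 2 * a)%:~R * (t + k%:~R * w)
    + (k * b - k ^+ 2 * a)%:~R ^+ 2).
    by ring.
  by rewrite ww wt tt !(intrD, intrM, intrN); ring.
Qed.

End CubicBasis.

(** * Discriminant and Hessian of the index form, and the trace form *)

Definition cubic_disc (a b c d : int) : int :=
  b ^+ 2 * c ^+ 2 - 4 * a * c ^+ 3 - 4 * b ^+ 3 * d + 18 * a * b * c * d
  - 27 * a ^+ 2 * d ^+ 2.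

(** The quadratic covariant (B^2 - 3 A C, B C - 9 A D, C^2 - 3 B D) of a binary cubic form, at the
    coefficients A = a, B = - b, C = c, D = - d of the index form. *)
Definition hessian (a b c d : int) : bqf :=
  (b ^+ 2 - 3 * a * c, 9 * a * d - b * c, c ^+ 2 - 3 * b * d).

Lemma hessian_disc a b c d :
  bqf_disc (hessian a b c d) = - 3 * cubic_disc a b c d.
Proof. by rewrite /bqf_disc /hessian /cubic_disc; ring. Qed.

Section TraceShape.
Variable K : fieldExtType rat.
Hypothesis K3 : is_cubic K.
Implicit Types (w t z : K).

Lemma field_trace_int (i : int) : field_trace (i%:~R : K) = (3 * i)%:~R.
Proof. by rewrite raddfMz /= field_trace1 K3 -[LHS]mulrzr intrM. Qed.

Lemma cubic_trace_w a b c d w t : cubic_basis a b c d w t ->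
  field_trace w = b%:~R.
Proof.
move=> [B ww wt tt]; have /Zbasis1P[fr _] := B.
(* The rows are the coordinates of w, w w and w t in the basis 1, w, t. *)
pose M : 'M[rat]_3 := \matrix_(i, j) nth 0 (nth [::]
  [:: [:: 0; 1; 0]; [:: - (a * c)%:~R; b%:~R; a%:~R]; [:: (a * d)%:~R; 0; 0]] i) j.
rewrite (@trace_mulmx _ _ [tuple 1; w; t] w M) //; last first.
  move=> i; rewrite !big_ord_recl big_ord0 !mxE addr0.
  case: i => [[|[|[|//]]] ?]; rewrite !(tnth_nth 0) /= ?scale0r ?scale1r ?scaleNr.
  - by rewrite mulr1; ring.
  - by rewrite !scaler_int ww !mulrzl; ring.
  - by rewrite !scaler_int wt; ring.
by rewrite /mxtrace !big_ord_recl big_ord0 !mxE /= !addr0 add0r.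
Qed.

Variables (a b c d : int) (w t : K).
Hypothesis wt_basis : cubic_basis a b c d w t.

Lemma cubic_trace (i j k : int) :
  field_trace (i%:~R + j%:~R * w + k%:~R * t) = (3 * i + b * j + c * k)%:~R.
Proof.
rewrite !raddfD /= field_trace_int !mulrzl !raddfMz /=.
rewrite (cubic_trace_w wt_basis) (cubic_trace_w (cubic_basis_swap wt_basis)).
by rewrite -!mulrzA -!intrD.
Qed.

Lemma cubic_gram_det :
  \det (gram [tuple 1; w; t]) = (cubic_disc a b c d)%:~R.
Proof.
have [B ww wt tt] := wt_basis.
have T1 : field_trace (1 : K) = 3 by rewrite field_trace1 K3.
have Tw := cubic_trace_w wt_basis.
have Tt := cubic_trace_w (cubic_basis_swap wt_basis).
have Tww : field_trace (w * w) = (b ^+ 2 - 2 * a * c)%:~R.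
  rewrite ww (_ : _ - _ = (- (a * c))%:~R + b%:~R * w + a%:~R * t).
    by rewrite cubic_trace; congr _%:~R; ring.
  by rewrite intrN; ring.
have Ttt : field_trace (t * t) = (c ^+ 2 - 2 * b * d)%:~R.
  rewrite tt (_ : _ - _ = (- (b * d))%:~R + d%:~R * w + c%:~R * t).
    by rewrite cubic_trace; congr _%:~R; ring.
  by rewrite intrN; ring.
have Twt : field_trace (w * t) = (3 * a * d)%:~R.
  by rewrite wt field_trace_int; congr _%:~R; ring.
rewrite (expand_det_row _ 0) !big_ord_recl big_ord0 addr0 /cofactor.
rewrite !(expand_det_row _ 0) !big_ord_recl !big_ord0 !addr0 /cofactor !det_mx11.
rewrite !mxE !(tnth_nth 0) /= ?mul1r ?mulr1 [t * w]mulrC.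
rewrite T1 Tw Tt Tww Twt Ttt /cubic_disc.
by rewrite !(intrD, intrM, intrN); ring.
Qed.

(** The determinant [u] of a change of basis enters squared. A discriminant known up to a square is
    enough to determine the resolvent field. *)
Lemma is_disc_cubic D : is_disc K D -> D != 0 /\
  exists u : int, D = u ^+ 2 * cubic_disc a b c d.
Proof.
move=> [e [eB De]].
have D0 : D != 0.
  rewrite -(intr_eq0 rat) -De; exact: gram_det_neq0 _ eB.1.
split=> //; have [B _ _ _] := wt_basis; move: e eB De.
rewrite K3 => e eB De; have [U eU] := Zbasis_change B eB.
exists (\det U); apply: (@intr_inj rat).
by rewrite -De -/(gram e) (gram_change eU) cubic_gram_det intrM rmorphXn.
Qed.

Let ew := 3 * w - b%:~R.
Let et := 3 * t - c%:~R.

Lemma cubic_shape_Zbasis : is_Zbasis (shape_lattice K) [tuple ew; et].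
Proof.
have /Zbasis1P[fr mem] := cubic_Zbasis wt_basis.
apply/Zbasis2P; split.
  apply/free2P => x y.
  rewrite /ew /et !scale_in_alg => h.
  have [] := (free3P 1 w t).1 fr (- x * b%:~R - y * c%:~R) (3 * x) (3 * y).
    rewrite !scale_in_alg -h !(rmorphB, rmorphD, rmorphM, rmorphN) !rmorph_int; ring.
  by move=> _ /eqP+ /eqP; rewrite !mulf_eq0 /= => /eqP-> /eqP->.
move=> z; split.
  move=> [z0 [n [u /mem[i [j [k ->]]] zE]]].
  exists j, k; rewrite /ew /et -!(mulrzl (_ - _)) zE.
  (* This trace is 3 (n + 3 i + b j + c k), so its vanishing determines n. *)
  have : field_trace ((n + 3 * i)%:~R + (3 * j)%:~R * w + (3 * k)%:~R * t) = 0.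
    by rewrite -[RHS]z0 zE; congr field_trace; rewrite !(intrD, intrM); ring.
  rewrite cubic_trace => /eqP; rewrite intr_eq0 => /eqP h.
  have -> : n = - (3 * i) - b * j - c * k by lia.
  by rewrite !(intrD, intrM, intrN); ring.
move=> [i [j zE]].
have {}zE : z = (- (b * i) - c * j)%:~R + (3 * i)%:~R * w + (3 * j)%:~R * t.
  by rewrite zE /ew /et -!(mulrzl (_ - _)) !(intrD, intrM, intrN); ring.
split.
  by rewrite zE cubic_trace; apply/eqP; rewrite intr_eq0; apply/eqP; ring.
exists (- (b * i) - c * j), (i%:~R * w + j%:~R * t).
  by apply/mem; exists 0, i, j; rewrite add0r.
by rewrite zE !intrM; ring.
Qed.

Lemma cubic_shape_trace (x y : int) :
  field_trace ((ew *~ x + et *~ y) ^+ 2) =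
  (6 * bqf_eval (hessian a b c d) x y)%:~R.
Proof.
have [B ww wt tt] := wt_basis.
rewrite (_ : _ ^+ 2 = 9 * x%:~R ^+ 2 * (w * w) + 18 * x%:~R * y%:~R * (w * t)
   + 9 * y%:~R ^+ 2 * (t * t)
   - 6 * (x%:~R * b%:~R + y%:~R * c%:~R) * (x%:~R * w + y%:~R * t)
   + (x * b + y * c)%:~R ^+ 2); last first.
  by rewrite /ew /et -!(mulrzl (_ - _)) intrD !intrM; ring.
rewrite ww wt tt.
(* The multiplication table gives the coordinates of the square in the basis 1, w, t, where
   [cubic_trace] applies. *)
rewrite [X in field_trace X](_ : _ =
  (- 9 * x * x * a * c + 18 * x * y * a * d - 9 * y * y * b * d
   + (x * b + y * c) * (x * b + y * c))%:~R
  + (9 * x * x * b + 9 * y * y * d - 6 * (x * b + y * c) * x)%:~R * w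
  + (9 * x * x * a + 9 * y * y * c - 6 * (x * b + y * c) * y)%:~R * t).
  rewrite cubic_trace; congr _%:~R; rewrite /bqf_eval /hessian; ring.
by rewrite !(intrD, intrM, intrN); ring.
Qed.

End TraceShape.

(** * The shape and its discriminant *)

Lemma bqf_primitive_bezout r s t : bqf_primitive (r, s, t) ->
  exists u v w : int, u * r + v * s + w * t = 1.
Proof.
rewrite /bqf_primitive => <-.
have [u [v uv]] := Bezoutz (gcdz r s) t.
have [u' [v' uv']] := Bezoutz r s.
by exists (u * u'), (u * v'), v; rewrite -uv -uv'; ring.
Qed.

(** Evaluation at (1,0), (0,1) and (1,1) recovers the coefficients. It also shows that n divides n'
    times each coefficient of Q', hence n' itself when these are coprime. *)
Lemma bqf_eval_comp (n n' : int) (Q Q' : bqf) (i j k l : int) :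
  (forall x y : int, n' * bqf_eval Q' x y =
     n * bqf_eval Q (i * x + k * y) (j * x + l * y)) ->
  n' ^+ 2 * bqf_disc Q' = n ^+ 2 * (i * l - j * k) ^+ 2 * bqf_disc Q /\
  (bqf_primitive Q' -> (n %| n')%Z).
Proof.
case: Q Q' => [[r s] t] [[r' s'] t'] h.
have Er := h 1 0; have Et := h 0 1; have Es := h 1 1.
rewrite /bqf_eval /bqf_disc /bqf_primitive in Er Et Es *.
have {}Er : n' * r' = n * (r * i ^+ 2 + s * i * j + t * j ^+ 2).
  by move: Er; rewrite !(mulr0, mulr1, addr0, expr0n, expr1n).
have {}Et : n' * t' = n * (r * k ^+ 2 + s * k * l + t * l ^+ 2).
  by move: Et; rewrite !(mulr0, mulr1, addr0, add0r, expr0n, expr1n).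
have {}Es : n' * s' = n * (2 * r * i * k + s * (i * l + j * k) + 2 * t * j * l).
  have -> : n' * s' = n' * (r' * 1 ^+ 2 + s' * 1 * 1 + t' * 1 ^+ 2)
    - n' * r' - n' * t' by ring.
  by rewrite Es Er Et; ring.
split=> [|prim].
  have -> : n' ^+ 2 * (s' ^+ 2 - 4 * r' * t') =
    (n' * s') ^+ 2 - 4 * (n' * r') * (n' * t') by ring.
  by rewrite Er Es Et; ring.
have [u [v [w uvw]]] := bqf_primitive_bezout prim.
rewrite -[n']mulr1 -uvw !mulrDr ![n' * (_ * _)]mulrCA Er Es Et.
by rewrite !rpredD //; apply/dvdz_mull/dvdz_mulr.
Qed.

Lemma bqf_disc_GL2Z Q Q' : GL2Z_equiv Q Q' -> bqf_disc Q' = bqf_disc Q.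
Proof.
move=> [g gu h].
have := @bqf_eval_comp 1 1 Q Q' (g 0 0) (g 1 0) (g 0 1) (g 1 1).
case=> [x y|]; first by rewrite !mul1r h.
have gd : \det g = g 0 0 * g 1 1 - g 1 0 * g 0 1.
  rewrite (expand_det_row _ 0) !big_ord_recl big_ord0 addr0 /cofactor !det_mx11.
  rewrite !mxE expr0 expr1 mulN1r mul1r mulrN [X in _ - X]mulrC.
  by congr (g _ _ * g _ _ - g _ _ * g _ _); apply: val_inj.
rewrite -gd expr1n !mul1r => -> _.
have [->|->] : \det g = 1 \/ \det g = -1.
  by move: gu; rewrite unitmxE => /orP[]/eqP; [left | right].
  by rewrite expr1n mul1r.
by rewrite sqrrN expr1n mul1r.
Qed.

Lemma bqf_content r s t : (r, s, t) != (0, 0, 0) :> bqf ->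
  exists m r' s' t', [/\ 0 < m, bqf_primitive (r', s', t') &
    (r, s, t) = (m * r', m * s', m * t') :> bqf].
Proof.
move=> nz; pose m := gcdz (gcdz r s) t.
have m0 : 0 < m.
  rewrite lt_neqAle andbT eq_sym; apply: contraNneq nz => /eqP.
  by rewrite !gcdz_eq0 => /andP[/andP[/eqP-> /eqP->] /eqP->].
have mrs : (m %| gcdz r s)%Z by rewrite dvdz_gcdl.
have /dvdzP[r' rE] : (m %| r)%Z by apply: dvdz_trans mrs (dvdz_gcdl _ _).
have /dvdzP[s' sE] : (m %| s)%Z by apply: dvdz_trans mrs (dvdz_gcdr _ _).
have /dvdzP[t' tE] : (m %| t)%Z by rewrite dvdz_gcdr.
exists m, r', s', t'; split=> //; last by rewrite rE sE tE ![_ * m]mulrC.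
rewrite /bqf_primitive; have : m * gcdz (gcdz r' s') t' = m * 1.
  rewrite mulr1 -[RHS]/(gcdz (gcdz r s) t) [in RHS]rE [in RHS]sE [in RHS]tE.
  have mm : `|m|%N = m :> int by lia.
  by rewrite -mulz_gcdl mm -mulz_gcdl mm mulrC.
by move/(mulfI (lt0r_neq0 m0)).
Qed.

Section Shape.
Variable K : fieldExtType rat.

(** The condition in [is_shape_form] with primitivity split off and the scaling made a parameter, so
    that two forms can be compared through their scalings. *)
Definition shape_form_scaled (n : int) (Q : bqf) : Prop :=
  exists e : 2.-tuple K,
    [/\ is_Zbasis (shape_lattice K) e, 0 < n &
        forall x y : int,
          field_trace ((tnth e 0 *~ x + tnth e 1 *~ y) ^+ 2) =
          (n * bqf_eval Q x y)%:~R].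

Lemma is_shape_formP Q : is_shape_form K Q <->
  bqf_primitive Q /\ exists n, shape_form_scaled n Q.
Proof.
split=> -[prim]; first by move=> [e [n H]]; split=> //; exists n, e.
by move=> [n [e H]]; split=> //; exists e, n.
Qed.

Lemma shape_form_compare n n' Q Q' :
  shape_form_scaled n Q -> shape_form_scaled n' Q' ->
  (exists u : int, n' ^+ 2 * bqf_disc Q' = n ^+ 2 * u ^+ 2 * bqf_disc Q) /\
  (bqf_primitive Q' -> (n %| n')%Z).
Proof.
move=> [e [eB n0 eQ]] [e' [eB' n0' eQ']].
have [U eU] := Zbasis_change eB eB'.
have [|Edisc dvd] := @bqf_eval_comp n n' Q Q' (U 0 0) (U 0 1) (U 1 0) (U 1 1).
  move=> x y; apply: (@intr_inj rat); rewrite -eQ -eQ'; congr field_trace.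
  have -> : (1 : 'I_2) = lift ord0 ord0 by apply: val_inj.
  rewrite !eU !big_ord_recl !big_ord0 !addr0 !mulrzDl !mulrzDr !mulrzA.
  by rewrite addrACA.
by split=> //; exists (U 0 0 * U 1 1 - U 0 1 * U 1 0).
Qed.

(** Two primitive forms have scalings that divide each other, hence are equal. Each discriminant is
    then an integer square times the other, and the two squares multiply to 1 unless the
    discriminants vanish. *)
Lemma shape_form_disc_unique Q Q' : is_shape_form K Q -> is_shape_form K Q' ->
  bqf_disc Q = bqf_disc Q'.
Proof.
suff dvd Q1 Q2 : is_shape_form K Q1 -> is_shape_form K Q2 ->
    exists u : int, bqf_disc Q2 = u ^+ 2 * bqf_disc Q1.
  move=> HQ HQ'; have [u uE] := dvd _ _ HQ HQ'; have [v vE] := dvd _ _ HQ' HQ.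
  have [Q0|Q0] := eqVneq (bqf_disc Q) 0; first by rewrite uE Q0 mulr0.
  have : (u * v) ^+ 2 = 1.
    apply: (mulIf Q0); rewrite mul1r [RHS]vE uE; ring.
  move=> /eqP; rewrite sqrf_eq1 => uv.
  have u1 : `|u|%N == 1%N.
    have : (`|u| * `|v| == 1)%N by rewrite -abszM; case/orP: uv => /eqP->.
    by rewrite muln_eq1 => /andP[].
  have u2 : u = 1 \/ u = -1 by lia.
  by rewrite uE; case: u2 => ->; rewrite ?sqrrN expr1n mul1r.
move=> /is_shape_formP[P1 [n1 H1]] /is_shape_formP[P2 [n2 H2]].
have [[u E] /(_ P2) dvd12] := shape_form_compare H1 H2.
have [_ /(_ P1) dvd21] := shape_form_compare H2 H1.
have [_ [_ n1_gt0 _]] := H1; have [_ [_ n2_gt0 _]] := H2.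
have n12 : n1 = n2.
  have : (`|n1| == `|n2|)%N by rewrite eqn_dvd -!dvdzE dvd12 dvd21.
  by lia.
exists u; apply: (@mulfI _ (n2 ^+ 2)); first by rewrite expf_neq0 // lt0r_neq0.
by rewrite E n12; ring.
Qed.

End Shape.

(** The basis 3 w - b, 3 t - c exhibits (r, s, q) as a shape form with scaling 6 m. Uniqueness and
    invariance under [GL2Z_equiv] settle all other forms of the shape. *)
Lemma shape_disc_cubic (K : fieldExtType rat) a b c d w t m r s q D :
  is_cubic K -> @cubic_basis K a b c d w t -> 0 < m ->
  bqf_primitive (r, s, q) -> hessian a b c d = (m * r, m * s, m * q) ->
  has_shape_of_disc D K <-> D = bqf_disc (r, s, q).
Proof.
move=> K3 B m0 prim hE.
have std : is_shape_form K (r, s, q).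
  split=> //; exists [tuple 3 * w - b%:~R; 3 * t - c%:~R], (6 * m); split.
  - exact: cubic_shape_Zbasis B.
  - by rewrite mulr_gt0.
  move=> x y; rewrite -[tnth _ 0]/(3 * w - b%:~R) -[tnth _ 1]/(3 * t - c%:~R).
  rewrite (cubic_shape_trace K3 B) hE /bqf_eval; congr _%:~R; ring.
split=> [[Q [Q0 Q0s /bqf_disc_GL2Z QQ0] <-]|->].
  by rewrite QQ0; apply: shape_form_disc_unique Q0s std.
exists (r, s, q) => //; exists (r, s, q) => //.
exists 1%:M; first exact: unitmx1.
by move=> x y; rewrite !mxE /= !mul1r !mul0r addr0 add0r.
Qed.

(** An isomorphism preserves and reflects roots of monic integer polynomials, hence maps integers
    onto integers with the same multiplication table. *)
Lemma cubic_basis_transport (K L : fieldExtType rat) (f : {rmorphism K -> L})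
    a b c d w t : bijective f ->
  cubic_basis a b c d w t -> cubic_basis a b c d (f w) (f t).
Proof.
move=> [g fK gK] [B ww wt tt].
have roif z : ring_of_integers (f z) <-> ring_of_integers z.
  split=> -[p pm pz]; exists p => //; move: pz;
  by rewrite !/(root _ _) -(fmorph_eq0 f) -horner_map -map_poly_comp
       (eq_map_poly (fun x => rmorph_int f x)).
split.
- have /Zbasis1P[fr mem] := B; apply/Zbasis1P; split.
    apply/free3P => i j k h; apply: ((free3P 1 w t).1 fr).
    apply: (fmorph_inj f); rewrite !rmorphD !fmorph_numZ rmorph1 rmorph0 //.
  move=> z; rewrite -[z]gK roif mem.
  split=> -[i [j [k zE]]]; exists i, j, k.
    by rewrite zE !rmorphD !rmorphM /= !rmorph_int.
  by apply: (fmorph_inj f); rewrite !rmorphD !rmorphM /= !rmorph_int.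
- by rewrite -rmorphM ww !(rmorphB, rmorphD) !rmorphM /= !rmorph_int.
- by rewrite -rmorphM wt rmorph_int.
- by rewrite -rmorphM tt !(rmorphB, rmorphD) !rmorphM /= !rmorph_int.
Qed.

(** * Consequences of maximality *)

(** Linear syzygies between a cubic form and its Hessian. They are homogeneous in the Hessian, so
    cancelling [m] carries them over to its primitive part. *)
Lemma hessian_syzygies a b c d m r s q : m != 0 ->
  hessian a b c d = (m * r, m * s, m * q) ->
  c * r + b * s + 3 * a * q = 0 /\ 3 * d * r + c * s + b * q = 0.
Proof.
move=> m0 [hr hs hq].
by split; apply: (mulfI m0); rewrite mulr0 !mulrDr ![m * (_ * _)]mulrCA;
  rewrite -hr -hs -hq; ring.
Qed.

Lemma hessian_swap a b c d m r s q :
  hessian a b c d = (m * r, m * s, m * q) ->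
  hessian d c b a = (m * q, m * s, m * r).
Proof. by case=> hr hs hq; rewrite /hessian -hr -hs -hq; congr (_, _, _); ring. Qed.

(** Covariance: the substitution x -> x + k y acts on the cubic form and on its Hessian alike. *)
Lemma hessian_shear a b c d m r s q k :
  hessian a b c d = (m * r, m * s, m * q) ->
  hessian a (b - 3 * a * k) (c - 2 * b * k + 3 * a * k ^+ 2)
    (d - c * k + b * k ^+ 2 - a * k ^+ 3) =
  (m * r, m * (s + 2 * k * r), m * (q + k * s + k ^+ 2 * r)).
Proof.
case=> hr hs hq; rewrite /hessian !mulrDr !(mulrCA m) -hr -hs -hq.
by congr (_, _, _); ring.
Qed.

Lemma prime_coprimez (p : nat) (n : int) : prime p -> ~~ (p %| n)%Z -> coprimez p n.
Proof. by move=> pp; rewrite coprimezE dvdzE /= prime_coprime. Qed.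

Section Maximality.
Variables (K : fieldExtType rat).

(** Under these divisibilities t / p is integral, which contradicts that t belongs to a Z-basis of
    the integers. *)
Lemma cubic_basis_max a b c d w t (p : nat) :
  @cubic_basis K a b c d w t -> (1 < p)%N ->
  (p %| c)%Z -> (p%:Z ^+ 2 %| d)%Z -> False.
Proof.
move=> [B ww wt tt] p1 /dvdzP[c' cE] /dvdzP[d' dE].
have /Zbasis1P[_ mem] := B.
have p0 : (p%:Z%:~R : K) != 0.
  rewrite -[_%:~R](rmorph_int (in_alg K)) fmorph_eq0 intr_eq0.
  by rewrite -lt0n (ltn_trans _ p1).
have [z tE] : exists z, t = z * p%:Z%:~R by exists (t / p%:Z%:~R); rewrite divfK.
have zR : ring_of_integers z.
  (* The cubic equation t^3 = c t^2 - b d t + a d^2 divided by p^3, coefficients listed from the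
     constant term upwards. *)
  exists (Poly [:: - (a * p * d' ^+ 2); b * d'; - c'; 1]).
    by rewrite monicE lead_coefE (@PolyK _ 1).
  rewrite /root /= !cons_poly_def !(rmorphD, rmorphM) /= !map_polyX !map_polyC /=.
  rewrite rmorph0 !hornerE.
  apply/eqP; apply: (mulIf (expf_neq0 3 p0)); rewrite mul0r.
  have t3 : t * (t * t) = (d * (a * d))%:~R + c%:~R * (t * t) - (b * d)%:~R * t.
    by rewrite {1}tt mulrBr mulrDr !mulrA [t * _ * w]mulrAC [t * w]mulrC wt !intrM; ring.
  move: t3; rewrite dE cE tE => t3.
  transitivity (z * p%:Z%:~R * (z * p%:Z%:~R * (z * p%:Z%:~R)) -
    (d' * p ^+ 2 * (a * (d' * p ^+ 2)))%:~R - (c' * p)%:~R * (z * p%:Z%:~R * (z * p%:Z%:~R))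
    + (b * (d' * p ^+ 2))%:~R * (z * p%:Z%:~R)).
    rewrite !(intrM, intrN). ring.
  by rewrite t3; ring.
have /mem[i [j [k zE]]] := zR.
have [|_ _ kp] := @Zbasis1_indep _ w t (i * p) (j * p) (k * p - 1) B.
  transitivity (z * p%:Z%:~R - t); last by rewrite tE subrr.
  by rewrite zE intrB !intrM; ring.
have : (`|k| * p == 1)%N by rewrite -[p]/`|p%:Z|%N -abszM; lia.
by rewrite muln_eq1 => /andP[_ /eqP p_eq1]; rewrite p_eq1 in p1.
Qed.

(** As r is invertible modulo p, the first syzygy gives p | c, and the second gives p^2 | 3 d r,
    hence p^2 | d if p is not 3. This contradicts [cubic_basis_max]. *)
Lemma cubic_basis_hessian_adapted a b c d w t m r s q (p : nat) :
  @cubic_basis K a b c d w t -> m != 0 ->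
  hessian a b c d = (m * r, m * s, m * q) ->
  prime p -> ~~ (p %| r)%Z -> (p %| s)%Z -> (p%:Z ^+ 2 %| q)%Z ->
  (p = 3%N -> (9 %| s)%Z /\ (27 %| q)%Z) -> False.
Proof.
move=> B m0 hE pp pr ps pq p3; have [E1 E2] := hessian_syzygies m0 hE.
have {}E1 : c * r = - (b * s + 3 * a * q) by rewrite -[LHS]subr0 -E1; ring.
have {}E2 : 3 * d * r = - (c * s + b * q) by rewrite -[LHS]subr0 -E2; ring.
have cr := prime_coprimez pp pr.
have pq1 : (p %| q)%Z by apply: dvdz_trans pq; rewrite dvdz_exp.
have pc : (p %| c)%Z.
  rewrite -(Gauss_dvdzl _ cr) E1.
  by rewrite rpredN rpredD // dvdz_mull.
apply: (cubic_basis_max B (prime_gt1 pp) pc).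
(* At 3 the stronger divisibilities give 9 | c, then 27 | 3 d r, which still leaves 9 | d. *)
have [p_eq3|p_neq3] := eqVneq p 3%N.
  have [s9 q27] := p3 p_eq3; subst p; rewrite (_ : 3%:Z ^+ 2 = 9) //.
  have q9 : (9 %| q)%Z by apply: dvdz_trans q27.
  have cr9 : coprimez 9 r by rewrite (_ : 9 = 3%:Z ^+ 2) // coprimezXl.
  have c9 : (9 %| c)%Z.
    rewrite -(Gauss_dvdzl _ cr9) E1.
    by rewrite rpredN rpredD // dvdz_mull.
  rewrite -(Gauss_dvdzl _ cr9) -(@dvdz_mul2l 3) // (_ : 3 * 9 = 27) //.
  rewrite mulrA E2.
  rewrite rpredN rpredD ?(dvdz_mull _ q27) //.
  by apply: (@dvdz_trans (9 * 9)) => //; apply: dvdz_mul.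
have cr3 : coprimez (p%:Z ^+ 2) (3 * r).
  rewrite coprimezXl // coprimezMr cr andbT prime_coprimez //.
  by rewrite dvdzE /= dvdn_prime2.
rewrite -(Gauss_dvdzl _ cr3) mulrCA mulrA E2.
by rewrite rpredN rpredD ?(dvdz_mull _ pq) // expr2 dvdz_mul.
Qed.

Lemma exists_shear_odd (r s : int) (p : nat) (j : nat) : prime p -> p != 2 ->
  ~~ (p %| r)%Z -> exists k, (p%:Z ^+ j %| s + 2 * k * r)%Z.
Proof.
move=> pp p2 pr.
have : coprimez (p%:Z ^+ j) (2 * r).
  rewrite coprimezXl // coprimezMr (prime_coprimez pp pr) andbT prime_coprimez //.
  by rewrite dvdzE /= dvdn_prime2.
move=> /coprimezP[[u v] /= uv].
(* By the Bezout relation, v is an inverse of 2 r modulo p^j. *)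
exists (- (v * s)).
rewrite (_ : _ + _ = s * u * p%:Z ^+ j); first exact: dvdz_mull.
transitivity (s * (u * p%:Z ^+ j + v * (2 * r)) - 2 * (v * s) * r); last by ring.
by rewrite uv; ring.
Qed.

(* That D = p^2 D' with D' again a discriminant, strengthened to 27 | D at
   p = 3, where the syzygies lose a factor 3. *)
Definition square_part_removable (p : nat) (D : int) : Prop :=
  if p == 2%N then exists D', D = 4 * D' /\ ((4 %| D')%Z \/ (4 %| D' - 1)%Z)
  else if p == 3%N then (27 %| D)%Z else (p%:Z ^+ 2 %| D)%Z.

(** The shear completes the square: the discriminant is S^2 - 4 r Q with S and Q the new
    coefficients. For odd p, k makes S divisible by p, or by 9 if p = 3, and the discriminant then
    passes its divisibility to Q because 4 r is invertible. *)
Lemma exists_shear (r s q : int) (p : nat) : prime p -> ~~ (p %| r)%Z ->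
  square_part_removable p (bqf_disc (r, s, q)) ->
  exists k, [/\ (p %| s + 2 * k * r)%Z, (p%:Z ^+ 2 %| q + k * s + k ^+ 2 * r)%Z &
    p = 3%N -> (9 %| s + 2 * k * r)%Z /\ (27 %| q + k * s + k ^+ 2 * r)%Z].
Proof.
move=> pp pr; rewrite /square_part_removable.
have DE k : bqf_disc (r, s, q) = (s + 2 * k * r) ^+ 2
    - 4 * r * (q + k * s + k ^+ 2 * r) by rewrite /bqf_disc; ring.
case: eqVneq => [p2 [D' [D4 D01]]|p2].
  subst p; move: pr D4; rewrite /bqf_disc => pr D4.
  have [s' sE] : exists s', s = 2 * s'.
    have : ~~ odd `|s|%N.
      have : ~~ odd (`|s| ^ 2)%N by rewrite -abszX; lia.
      by rewrite oddX.
    by exists (s %/ 2)%Z; lia.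
  have {}D4 : D' = s' ^+ 2 - r * q.
    by apply: (@mulfI _ 4) => //; rewrite -D4 sE; ring.
  have [r' rE] : exists r', r = 2 * r' + 1 by exists (r %/ 2)%Z; lia.
  have cop4 : coprimez 4 r.
    by rewrite (_ : 4 = 2%:Z ^+ 2) // coprimezXl // prime_coprimez.
  (* Since r is odd, k = s' makes s' + k r even and k = s' + 1 makes it odd; its square is then 0 or
     1 modulo 4, as D' is. *)
  have [k k4] : exists k, (4 %| (s' + k * r) ^+ 2 - D')%Z.
    case: D01 => [D0|D1].
      exists s'; rewrite rpredB //.
      by apply/dvdzP; exists ((s' * (r' + 1)) ^+ 2); rewrite rE; ring.
    exists (s' + 1); rewrite (_ : _ - D' = ((s' + (s' + 1) * r) ^+ 2 - 1) - (D' - 1)).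
      rewrite rpredB //; apply/dvdzP.
      by exists ((s' * (r' + 1) + r') ^+ 2 + (s' * (r' + 1) + r')); rewrite rE; ring.
    by ring.
  exists k; split=> //.
    by rewrite sE -mulrA -mulrDr dvdz_mulr.
  rewrite (_ : 2%:Z ^+ 2 = 4) // -(Gauss_dvdzr _ cop4).
  rewrite (_ : r * _ = (s' + k * r) ^+ 2 - D') // D4 sE; ring.
have cop4r : coprimez (p%:Z) (4 * r).
  rewrite coprimezMr (prime_coprimez pp pr) andbT prime_coprimez //.
  rewrite dvdzE -[X in (_ %| X)%N]/(2 ^ 2)%N Euclid_dvdX // andbT.
  by rewrite dvdn_prime2.
case: eqVneq => [p3 D27|p3 Dp].
  subst p; have [k k9] := exists_shear_odd s 2 pp p2 pr.
  have q27 : (27 %| q + k * s + k ^+ 2 * r)%Z.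
    have cop27 : coprimez 27 (4 * r) by rewrite (_ : 27 = 3%:Z ^+ 3) // coprimezXl.
    rewrite -(Gauss_dvdzr _ cop27).
    rewrite (_ : _ * _ = (s + 2 * k * r) ^+ 2 - bqf_disc (r, s, q)).
      rewrite rpredB // expr2; apply: (@dvdz_trans (9 * 9)) => //.
      exact: dvdz_mul.
    by rewrite (DE k); ring.
  exists k; split=> //; first by apply: dvdz_trans k9.
  by apply: dvdz_trans q27.
have [k kp] := exists_shear_odd s 1 pp p2 pr; rewrite expr1 in kp.
exists k; split=> //; last by move=> p_eq3; rewrite p_eq3 in p3.
rewrite -(Gauss_dvdzr _ (coprimezXl 2 cop4r)).
rewrite (_ : _ * _ = (s + 2 * k * r) ^+ 2 - bqf_disc (r, s, q)).
  by rewrite rpredB // !expr2 dvdz_mul.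
by rewrite (DE k); ring.
Qed.

(** A swap of w and t exchanges r and q, so p may be taken prime to r unless it divides both. In
    that case p divides s^2 = disc + 4 r q, against primitivity. A shear then leads to the adapted
    situation. *)
Lemma cubic_basis_removable a b c d w t m r s q (p : nat) :
  @cubic_basis K a b c d w t -> m != 0 ->
  hessian a b c d = (m * r, m * s, m * q) -> bqf_primitive (r, s, q) ->
  prime p -> ~ square_part_removable p (bqf_disc (r, s, q)).
Proof.
move=> B m0 hE prim pp sq.
wlog pr : a b c d w t r q B hE prim sq / ~~ (p %| r)%Z.
  have [pr|pr] := boolP (p %| r)%Z; last by apply; eauto.
  have [pq|pq] := boolP (p %| q)%Z; last first.
    move/(_ d c b a t w q r (cubic_basis_swap B) (hessian_swap hE)); apply=> //.
      by rewrite /bqf_primitive gcdzC [gcdz q s]gcdzC gcdzA.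
    by move: sq; rewrite /bqf_disc mulrAC.
  move=> _.
  have ps : ~~ (p %| s)%Z.
    apply/negP => ps; have [u [v [x uvx]]] := bqf_primitive_bezout prim.
    have : (p %| u * r + v * s + x * q)%Z by rewrite !rpredD // dvdz_mull.
    by rewrite uvx dvdzE /= dvdn1 => /eqP p1; rewrite p1 in pp.
  have : (p %| s ^+ 2)%Z.
    rewrite (_ : s ^+ 2 = bqf_disc (r, s, q) + 4 * r * q); last by rewrite /bqf_disc; ring.
    rewrite rpredD //; last by apply: dvdz_mull.
    move: sq; rewrite /square_part_removable.
    case: eqVneq => [-> [D' [-> _]]|_].
      by rewrite dvdz_mulr.
    case: eqVneq => [->|_]; first by apply: dvdz_trans.
    by apply: dvdz_trans; rewrite dvdz_exp.
  by rewrite expr2 dvdzE abszM Euclid_dvdM // orbb -dvdzE (negPf ps).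
have [k [ks kq k3]] := exists_shear pp pr sq.
exact: cubic_basis_hessian_adapted (cubic_basis_shear k B) m0
  (hessian_shear k hE) pp pr ks kq k3.
Qed.
End Maximality.

(** * Fundamental discriminants and quadratic fields *)

(** Dividing by g = gcd(m, k) leaves coprime m' and k' with m' | k'^2 g, so m' | g. Then m'^2
    divides m = m' g, and m' = 1. *)
Lemma squarefree_dvd_sqr (m k : int) :
  squarefree m -> (m %| k ^+ 2)%Z -> (m %| k)%Z.
Proof.
move=> sf; have m0 : (0 < `|m|)%N.
  by rewrite lt0n; apply/negP => /eqP m0; have := sf 2%N; rewrite m0 => /(_ isT).
rewrite !dvdzE abszX => mk.
pose g := gcdn `|m| `|k|; have g0 : (0 < g)%N by rewrite gcdn_gt0 m0.
have [m' mE] : exists m', `|m|%N = (m' * g)%N by apply/dvdnP; rewrite dvdn_gcdl.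
have [k' kE] : exists k', `|k|%N = (k' * g)%N by apply/dvdnP; rewrite dvdn_gcdr.
have cop : coprime m' k'.
  by rewrite /coprime -(eqn_pmul2r g0) mul1n muln_gcdl -mE -kE.
have : (m' %| g)%N.
  move: mk; rewrite mE kE expnMn [(g ^ 2)%N]expnS expn1 mulnA dvdn_pmul2r //.
  by rewrite Gauss_dvdr // coprimeXr.
move=> /dvdnP[h gE].
have m'1 : m' = 1%N by apply: sf; rewrite mE gE mulnCA dvdn_mull.
by rewrite mE kE m'1 dvdn_mul.
Qed.

Lemma squarefree_mul_prime (p : nat) (m : int) : prime p -> ~~ (p %| m)%Z ->
  squarefree m -> squarefree (- (p%:Z * m)).
Proof.
move=> pp pm sf k; rewrite abszN abszM => kpm; apply: sf.
have ckp : coprime (k ^ 2) p.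
  rewrite coprimeXl // coprime_sym prime_coprime //; apply/negP => pk.
  have : (p ^ 2 %| p * `|m|)%N by apply: dvdn_trans kpm; rewrite dvdn_exp2r.
  rewrite expnS expn1 dvdn_pmul2l ?prime_gt0 // => pm'.
  by move: pm; rewrite dvdzE /= pm'.
by move: kpm; rewrite Gauss_dvdr.
Qed.

Lemma squarefree_div (p m : int) : squarefree (- (p * m)) -> squarefree m.
Proof. by move=> sf k km; apply: sf; rewrite abszN abszM dvdn_mull. Qed.

Lemma fundamental_neq0 d : fundamental_discriminant d -> d != 0.
Proof.
by case=> [[d1 _]|[m [dE m1 _]]]; apply/eqP; lia.
Qed.

Lemma fundamental_mod4 d : fundamental_discriminant d ->
  (4 %| d)%Z \/ (4 %| d - 1)%Z.
Proof.
case=> [[d1 _]|[m [-> _ _]]]; last by left; rewrite dvdz_mulr.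
by right; rewrite -eqz_mod_dvd; apply/eqP.
Qed.

(* Q(sqrt d') is the mirror field Q(sqrt (-3 d)) of Q(sqrt d). *)
Lemma fundamental_mirror d : fundamental_discriminant d ->
  exists2 d', fundamental_discriminant d' &
    if (3 %| d)%Z then d = - (3 * d') else d' = - (3 * d).
Proof.
move=> fd; have [/dvdzP[e dE]|d3] := boolP (3 %| d)%Z.
  exists (- e); last by rewrite dE; ring.
  case: fd => [[d1 sf]|[m [d4 m1 sf]]].
    left; split; first by apply/eqP; rewrite eqz_mod_dvd; move: d1; lia.
    by apply: (@squarefree_div 3); rewrite mulrN opprK mulrC -dE.
  have [m' mE] : exists m', m = - (3 * m') by exists (- (m %/ 3)%Z); lia.
  right; exists m'; split; [lia | lia |].
  by apply: (@squarefree_div 3); rewrite -mE.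
exists (- (3 * d)) => //.
have p3 : prime 3 by [].
case: fd => [[d1 sf]|[m [d4 m1 sf]]].
  left; split; first lia.
  exact: squarefree_mul_prime p3 d3 sf.
right; exists (- (3 * m)); split; [by rewrite d4; ring | lia |].
apply: squarefree_mul_prime p3 _ sf; apply/negP => m3.
by move/negP: d3; apply; rewrite d4 dvdz_mull.
Qed.

(** For squarefree d, d divides k. For d = 4 m the same argument applied to m gives D = m j^2, and
    congruences modulo 4 make j even. *)
Lemma fundamental_square d D k : fundamental_discriminant d ->
  (4 %| D)%Z \/ (4 %| D - 1)%Z -> d * D = k ^+ 2 -> exists g, D = d * g ^+ 2.
Proof.
move=> fd D01 dD; have := fundamental_neq0 fd.
case: fd => [[_ sf]|[m [dE m1 sf]]] d0; last subst d.
  have /dvdzP[g kE] : (d %| k)%Z.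
    by apply: squarefree_dvd_sqr => //; rewrite -dD dvdz_mulr.
  by exists g; apply: (mulfI d0); rewrite dD kE; ring.
have [k' kE] : exists k', k = 2 * k'.
  have : ~~ odd (`|k| ^ 2)%N by rewrite -abszX -dD -mulrA abszM oddM.
  by rewrite oddX /= => k_even; exists (k %/ 2)%Z; lia.
have m0 : m != 0 by apply: contraNneq d0 => ->; rewrite mulr0.
have mD : m * D = k' ^+ 2.
  by apply: (@mulfI _ 4) => //; rewrite mulrA dD kE; ring.
have /dvdzP[j k'E] : (m %| k')%Z.
  by apply: squarefree_dvd_sqr => //; rewrite -mD dvdz_mulr.
have {}DE : D = m * j ^+ 2 by apply: (mulfI m0); rewrite mD k'E; ring.
(* An odd j would give D = m modulo 4, that is 2 or 3, which a discriminant cannot be. *)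
have [j' jE] : exists j', j = 2 * j'.
  have [odd_j|] := boolP (odd `|j|%N); last by exists (j %/ 2)%Z; lia.
  have [h jE] : exists h, j = 2 * h + 1 by exists (j %/ 2)%Z; lia.
  have {}DE : D = m + 4 * (m * (h ^+ 2 + h)) by rewrite DE jE; ring.
  by move: (m * _) DE => x DE; lia.
by exists j'; rewrite DE jE; ring.
Qed.

Lemma sqr_of_mul_sqr (x y z : int) : y != 0 -> x * y ^+ 2 = z ^+ 2 ->
  exists w, x = w ^+ 2.
Proof.
move=> y0 xy; have /dvdzP[w zE] : (y %| z)%Z.
  by rewrite -(@dvdz_pexp2r _ _ 2) // -xy dvdz_mull.
exists w; apply: (@mulIf _ (y ^+ 2)); first by rewrite expf_neq0.
by rewrite xy zE exprMn.
Qed.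

Lemma quadratic_field_sub (a b w : int) : b != 0 -> a * b = w ^+ 2 ->
  (quadratic_field a `<=` quadratic_field b)%classic.
Proof.
move=> b0 ab z [x [y ->]].
have b0' : (b%:~R : algC) != 0 by rewrite intr_eq0.
have [e eE] : exists e : rat, sqrtC a%:~R * sqrtC b%:~R = ratr e :> algC.
  have : (sqrtC a%:~R * sqrtC b%:~R) ^+ 2 = (w%:~R : algC) ^+ 2.
    by rewrite exprMn !sqrtCK -intrM ab rmorphXn.
  move=> /eqP; rewrite eqf_sqr => /orP[]/eqP ->.
    by exists w%:~R; rewrite ratr_int.
  by exists (- w%:~R); rewrite rmorphN /= ratr_int.
have -> : sqrtC a%:~R = ratr (e / b%:~R) * sqrtC b%:~R :> algC.
  rewrite rmorphM fmorphV /= ratr_int -eE mulrAC -[_ * _ * sqrtC b%:~R]mulrA.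
  by rewrite -expr2 sqrtCK mulfK.
by exists x, (y * (e / b%:~R)); rewrite [ratr (y * _)]rmorphM mulrA.
Qed.

(** Write sqrt a = x + y sqrt b with x, y rational. If x = 0 then a b = (y b)^2; in the other cases
    both square roots turn out rational. *)
Lemma quadratic_field_eqP (a b : int) : a != 0 -> b != 0 ->
  quadratic_field a = quadratic_field b <-> exists w, a * b = w ^+ 2.
Proof.
move=> a0 b0; split; last first.
  move=> [w ab]; apply/seteqP; split; apply: quadratic_field_sub => //; eauto.
  by rewrite mulrC; exact: ab.
move=> ab.
(* An integer that is the square of a rational is the square of an integer. *)
suff [q qE] : exists q : rat, (a * b)%:~R = q ^+ 2.
  apply: (@sqr_of_mul_sqr _ (denq q) (numq q)); first exact: denq_neq0.
  apply: (@intr_inj rat); rewrite intrM qE !rmorphXn /= -[q in q ^+ 2]divq_num_den.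
  by rewrite -exprMn divfK // intr_eq0 denq_neq0.
have mem c : quadratic_field c (sqrtC c%:~R).
  by exists 0, 1; rewrite rmorph0 rmorph1 add0r mul1r.
have := mem a; rewrite ab => -[x [y aE]].
have := mem b; rewrite -ab => -[x' [y' bE]].
have rat_sqr (c : int) (r : rat) : sqrtC c%:~R = ratr r :> algC -> c%:~R = r ^+ 2.
  move=> cr; apply: (fmorph_inj (@ratr algC)); rewrite /= rmorphXn /= -cr sqrtCK.
  by rewrite ratr_int.
have both r s : sqrtC a%:~R = ratr r :> algC -> sqrtC b%:~R = ratr s :> algC ->
    exists q : rat, (a * b)%:~R = q ^+ 2.
  by move=> /rat_sqr ar /rat_sqr bs; exists (r * s); rewrite intrM ar bs exprMn.
have [y0|y0] := eqVneq y 0.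
  have {}aE : sqrtC a%:~R = ratr x :> algC by rewrite aE y0 rmorph0 mul0r addr0.
  apply: (both x (x' + y' * x)) => //.
  by rewrite bE aE !(rmorphD, rmorphM).
have [x0|x0] := eqVneq x 0.
  exists (y * b%:~R); apply: (fmorph_inj (@ratr algC)).
  rewrite /= ratr_int rmorphXn /= [ratr (y * _)]rmorphM /= ratr_int intrM.
  rewrite -[a%:~R]sqrtCK aE x0 rmorph0 add0r.
  by rewrite exprMn sqrtCK; ring.
(* Squaring sqrt a = x + y sqrt b and solving for sqrt b, as x y is nonzero. *)
pose s := (a%:~R - x ^+ 2 - y ^+ 2 * b%:~R) / (2 * x * y).
have bs : sqrtC b%:~R = ratr s :> algC.
  have n0 : ratr (2 * x * y) != 0 :> algC by rewrite fmorph_eq0 !mulf_neq0.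
  apply: (mulIf n0); rewrite -rmorphM /= divfK ?mulf_neq0 //.
  have aE2 : a%:~R = ratr x ^+ 2 + ratr y ^+ 2 * b%:~R
      + 2 * ratr x * ratr y * sqrtC b%:~R :> algC.
    rewrite -[LHS]sqrtCK aE; move: (sqrtC (b%:~R : algC)) (sqrtCK (b%:~R : algC)) => u <-.
    by ring.
  rewrite !(rmorphB, rmorphM) /= !ratr_int rmorph_nat aE2; ring.
apply: (both (x + y * s) s) => //.
by rewrite aE bs rmorphD rmorphM.
Qed.

Lemma bqf_disc_mod4 Q : (4 %| bqf_disc Q)%Z \/ (4 %| bqf_disc Q - 1)%Z.
Proof.
case: Q => [[r s] q]; rewrite /bqf_disc.
have [odd_s|even_s] := boolP (odd `|s|%N); [right|left].
  have [h sE] : exists h, s = 2 * h + 1 by exists (s %/ 2)%Z; lia.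
  by apply/dvdzP; exists (h ^+ 2 + h - r * q); rewrite sE; ring.
have [h sE] : exists h, s = 2 * h by exists (s %/ 2)%Z; lia.
by apply/dvdzP; exists (h ^+ 2 - r * q); rewrite sE; ring.
Qed.

(** The point is p = 2: with g = 2 h, the quotient d h^2 is again 0 or 1 modulo 4. *)
Lemma fundamental_square_removable d g (p : nat) : fundamental_discriminant d ->
  prime p -> p != 3%N -> (p %| g)%Z -> square_part_removable p (d * g ^+ 2).
Proof.
move=> fd pp p3 /dvdzP[h gE]; rewrite /square_part_removable (negPf p3).
case: eqVneq => [p2|_]; last by rewrite gE exprMn mulrA dvdz_mull.
exists (d * h ^+ 2); split; first by rewrite gE p2; ring.
have [even_h|odd_h] := boolP (odd `|h|%N); last first.
  have [j hE] : exists j, h = 2 * j by exists (h %/ 2)%Z; lia.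
  by left; apply/dvdzP; exists (d * j ^+ 2); rewrite hE; ring.
have [j hE] : exists j, h = 2 * j + 1 by exists (h %/ 2)%Z; lia.
have [d4|d4] := fundamental_mod4 fd; [by left; rewrite dvdz_mulr | right].
rewrite (_ : _ - 1 = d * (j ^+ 2 + j) * 4 + (d - 1)); last by rewrite hE; ring.
by rewrite rpredD // dvdz_mull.
Qed.

Lemma prime_divisor_free (n : int) : n != 0 ->
  (forall p : nat, prime p -> ~~ (p %| n)%Z) -> n ^+ 2 = 1.
Proof.
move=> n0 np; have n1 : `|n|%N = 1%N.
  apply/eqP; rewrite eqn_leq absz_gt0 n0 andbT leqNgt; apply/negP => n1.
  have := np _ (pdiv_prime n1).
  by rewrite dvdzE /= pdiv_dvd.
by rewrite -[n ^+ 2]gez0_abs ?sqr_ge0 // abszX n1.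
Qed.

(** * The resolvent field in terms of the discriminant of the shape *)

Lemma cubic_resolvent_shape (K : fieldExtType rat) (d : int) :
  fundamental_discriminant d -> is_cubic K -> (exists D, is_disc K D) ->
  has_resolvent d K <-> has_shape_of_disc (- (3 * d)) K \/
    (3 %| d)%Z /\ has_shape_of_disc (- (d %/ 3)%Z) K.
Proof.
move=> fd K3 [D0 [e [eB D0E]]].
have [a [b [c [e' [w [t B]]]]]] := cubic_basis_exists K3 eB.
have D0K : is_disc K D0 by exists e.
have [D0_neq0 [u0 u0E]] := is_disc_cubic K3 B D0K.
have d0 := fundamental_neq0 fd.
have disc0 : cubic_disc a b c e' != 0.
  by apply: contraNneq D0_neq0 => disc0; rewrite u0E disc0 mulr0.
have hE0 := hessian_disc a b c e'.
have h0 : bqf_disc (hessian a b c e') != 0 by rewrite hE0 mulf_neq0.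
have [|m [r [s [q [m_gt0 prim hE]]]]] := @bqf_content (b ^+ 2 - 3 * a * c)
  (9 * a * e' - b * c) (c ^+ 2 - 3 * b * e').
  by apply: contraNneq h0; rewrite /hessian => ->.
have m0 : m != 0 by rewrite lt0r_neq0.
have shapeP D := shape_disc_cubic D K3 B m_gt0 prim hE.
pose Delta := bqf_disc (r, s, q).
have mD : m ^+ 2 * Delta = - 3 * cubic_disc a b c e'.
  by rewrite -hE0 /hessian hE /Delta /bqf_disc; ring.
have Delta0 : Delta != 0.
  apply: contraNneq h0 => Delta0; rewrite hE0 -mD Delta0 mulr0 //.
rewrite !shapeP -/Delta; split; last first.
  move=> DE; exists D0 => //; apply/quadratic_field_eqP => //.
  (* The witnesses come from disc = d m^2 in the first case, and from 3 disc = f m^2 with d = 3 f in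
     the second. *)
  case: DE => [DE|[/dvdzP[f dE] DE]].
    exists (d * m * u0); rewrite u0E.
    have -> : cubic_disc a b c e' = d * m ^+ 2.
      by apply: (@mulfI _ (- 3)) => //; rewrite -mD -DE; ring.
    by ring.
  exists (f * m * u0); rewrite u0E dE.
  move: DE; rewrite dE mulzK // => DE.
  have := mD; rewrite -DE => /eqP; rewrite mulrN mulNr eqr_opp => /eqP fE.
  transitivity (f * u0 ^+ 2 * (3 * cubic_disc a b c e')); first by ring.
  by rewrite -fE; ring.
move=> [D DK DQ].
have [D_neq0 [u uE]] := is_disc_cubic K3 B DK.
have u_neq0 : u != 0 by apply: contraNneq D_neq0 => u0'; rewrite uE u0' expr0n mul0r.
have /(quadratic_field_eqP D_neq0 d0)[k kE] := DQ.
have [d' fd' dd'] := fundamental_mirror fd.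
(* From - 3 disc = m^2 Delta and D d = k^2. *)
have key : - 3 * d * Delta * (m * u) ^+ 2 = (3 * k) ^+ 2.
  transitivity (- 3 * d * u ^+ 2 * (m ^+ 2 * Delta)); first by ring.
  by rewrite mD exprMn -kE uE; ring.
(* The factor - 3 d is 9 d' or d' according to whether 3 divides d; the remaining square factors
   cancel. *)
have [k' k'E] : exists k', d' * Delta = k' ^+ 2.
  have [d3|d3] := boolP (3 %| d)%Z; rewrite ?d3 ?(negPf d3) in dd'.
    apply: (@sqr_of_mul_sqr _ (3 * (m * u)) (3 * k)); first by rewrite !mulf_neq0.
    by rewrite -key dd'; ring.
  apply: (@sqr_of_mul_sqr _ (m * u) (3 * k)); first by rewrite !mulf_neq0.
  by rewrite -key dd'; ring.
have [g DeltaE] := fundamental_square fd' (bqf_disc_mod4 _) k'E.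
have no_rem p (pp : prime p) := cubic_basis_removable B m0 hE prim pp.
rewrite -/Delta in no_rem DeltaE.
have pg p : prime p -> (p %| g)%Z -> p = 3%N.
  move=> pp pg; apply/eqP/negP => /negP p3; apply: (no_rem p pp).
  by rewrite DeltaE; apply: fundamental_square_removable.
have not27 : ~~ (27 %| Delta)%Z by apply/negP; apply: (no_rem 3%N).
have g0 : g != 0 by apply: contraNneq Delta0 => g0; rewrite DeltaE g0 expr0n mulr0.
have [d3|d3] := boolP (3 %| d)%Z; rewrite ?d3 ?(negPf d3) in dd'; last first.
  (* Here d' = - 3 d already contains a factor 3, so 3 | g would give 27 | Delta. Hence g^2 = 1. *)
  left; rewrite -dd' DeltaE prime_divisor_free ?mulr1 // => p pp.
  apply/negP => pg'; have p3 := pg p pp pg'; move: pg'; rewrite p3 => /dvdzP[h gE].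
  move/negP: not27; apply; rewrite DeltaE gE dd'.
  by apply/dvdzP; exists (- d * h ^+ 2); ring.
have -> : (d %/ 3)%Z = - d' by rewrite dd' -mulrN mulKz.
(* Here d = - 3 d'. If 3 does not divide g, then Delta = d'. Otherwise g = 3 h with h^2 = 1, as 9 |
   g would give 81 | Delta, and Delta = 9 d' = - 3 d. *)
have [g3|g3] := boolP (3 %| g)%Z; last first.
  right; split=> //; rewrite opprK DeltaE prime_divisor_free ?mulr1 // => p pp.
  by apply/negP => pg'; have p3 := pg p pp pg'; rewrite p3 (negPf g3) in pg'.
left; move: g3 => /dvdzP[h gE]; have h0' : h != 0 by apply: contraNneq g0 => h0'; rewrite gE h0'.
rewrite dd' DeltaE gE exprMn prime_divisor_free //; first by ring.
move=> p pp; apply/negP => ph.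
have p3 : p = 3%N by apply: pg => //; rewrite gE dvdz_mulr.
move: ph; rewrite p3 => /dvdzP[j hE'].
move/negP: not27; apply; rewrite DeltaE gE hE'.
by apply/dvdzP; exists (3 * d' * j ^+ 2); ring.
Qed.

(** A basis of K transported to L has the same Hessian, whose primitive part determines both
    discriminants. *)
Lemma shape_disc_iso (K L : fieldExtType rat) (D D' : int) :
  is_cubic K -> is_cubic L -> field_iso K L -> (exists E, is_disc K E) ->
  has_shape_of_disc D K -> has_shape_of_disc D' L -> D = D'.
Proof.
move=> K3 L3 [f fbij] [D0 [e [eB D0E]]].
have [a [b [c [e' [w [t B]]]]]] := cubic_basis_exists K3 eB.
have D0K : is_disc K D0 by exists e.
have [D0_neq0 [u0 u0E]] := is_disc_cubic K3 B D0K.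
have h0 : bqf_disc (hessian a b c e') != 0.
  rewrite hessian_disc mulf_neq0 //.
  by apply: contraNneq D0_neq0 => disc0; rewrite u0E disc0 mulr0.
have [|m [r [s [q [m_gt0 prim hE]]]]] := @bqf_content (b ^+ 2 - 3 * a * c)
  (9 * a * e' - b * c) (c ^+ 2 - 3 * b * e').
  by apply: contraNneq h0; rewrite /hessian => ->.
move=> /(shape_disc_cubic _ K3 B m_gt0 prim hE) ->.
by move=> /(shape_disc_cubic _ L3 (cubic_basis_transport fbij B) m_gt0 prim hE).
Qed.

(** * Counting isomorphism classes *)

Lemma field_iso_sym K L : field_iso K L -> field_iso L K.
Proof.
move=> [f [g fK gK]].
pose gA := GRing.isZmodMorphism.Build L K g (can2_zmod_morphism fK gK).
pose gM := GRing.isMultiplicative.Build L K g (can2_rmorphism fK gK).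
pose gR : {rmorphism L -> K} := HB.pack g gA gM.
by exists gR; exists f.
Qed.

Lemma field_iso_trans K L M : field_iso K L -> field_iso L M -> field_iso K M.
Proof. by move=> [f fb] [g gb]; exists (g \o f); apply: bij_comp. Qed.

Lemma iso_classes_le P n m :
  has_iso_classes P n -> has_iso_classes P m -> (n <= m)%N.
Proof.
move=> [F [PF injF _]] [G [_ _ surjG]].
pose h i := sval (cid (surjG (F i) (PF i))).
have hP i : field_iso (F i) (G (h i)) := svalP (cid (surjG (F i) (PF i))).
rewrite -[n]card_ord -[m]card_ord; apply: (@leq_card _ _ h) => i j hij.
by apply/injF/(field_iso_trans (hP i)); rewrite hij; apply: field_iso_sym.
Qed.

Section Count.
Variable R : realType.
Implicit Types P : fieldExtType rat -> Prop.

Lemma iso_class_countE P n :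
  has_iso_classes P n -> iso_class_count R P = n%:R%:E.
Proof.
move=> Pn; rewrite /iso_class_count; case: pselect => [h|[]]; last by exists n.
have Pm := svalP (cid h); congr (_%:R%:E).
by apply/eqP; rewrite eqn_leq !(@iso_classes_le P).
Qed.

Lemma iso_class_count_infinite P :
  ~ (exists n, has_iso_classes P n) -> iso_class_count R P = +oo%E.
Proof. by rewrite /iso_class_count; case: pselect. Qed.

(** The representatives that satisfy [P1] are kept; stability of [P1] under isomorphism within [P]
    ensures that they still reach every field satisfying [P1]. *)
Lemma has_iso_classes_sub P P1 n : has_iso_classes P n ->
  (forall K, P1 K -> P K) ->
  (forall K L, P1 K -> P L -> field_iso K L -> P1 L) ->
  exists n1, has_iso_classes P1 n1.
Proof.
move=> [F [PF injF surjF]] P1P P1iso; pose S := [set i | `[< P1 (F i) >]]%SET.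
exists #|S|, (fun j => F (enum_val j)); split.
- by move=> j; have := enum_valP j; rewrite inE => /asboolP.
- by move=> i j /injF /enum_val_inj.
move=> K P1K; have [i Ki] := surjF K (P1P K P1K).
have iS : i \in S by rewrite inE; apply/asboolP; apply: P1iso P1K (PF i) Ki.
by exists (enum_rank_in iS i); rewrite enum_rankK_in.
Qed.

Lemma has_iso_classes_add P P1 P2 n1 n2 :
  has_iso_classes P1 n1 -> has_iso_classes P2 n2 ->
  (forall K, P K <-> P1 K \/ P2 K) ->
  (forall K L, P1 K -> P2 L -> ~ field_iso K L) ->
  has_iso_classes P (n1 + n2).
Proof.
move=> [F1 [PF1 inj1 surj1]] [F2 [PF2 inj2 surj2]] PE P12.
pose F i := match fintype.split i with inl j => F1 j | inr j => F2 j end.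
exists F; split.
- by move=> i; rewrite PE /F; case: fintype.split => j; [left | right].
- move=> i j; rewrite /F -[RHS]splitK -[LHS]splitK.
  case: (fintype.split i) => i'; case: (fintype.split j) => j'; rewrite ?unsplitK.
  + by move=> /inj1 ->.
  + by move=> /(P12 _ _ (PF1 i') (PF2 j')).
  + by move=> /field_iso_sym /(P12 _ _ (PF1 j') (PF2 i')).
  + by move=> /inj2 ->.
move=> K /PE[/surj1|/surj2] [j Kj].
  by exists (lshift n2 j); rewrite /F (unsplitK (inl j)).
by exists (rshift n1 j); rewrite /F (unsplitK (inr j)).
Qed.

Lemma iso_class_count_add P P1 P2 : (forall K, P K <-> P1 K \/ P2 K) ->
  (forall K L, P1 K -> P2 L -> ~ field_iso K L) ->
  iso_class_count R P = (iso_class_count R P1 + iso_class_count R P2)%E.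
Proof.
move=> PE P12.
(* Stability of each part under isomorphism follows from the absence of isomorphisms between the two
   parts. So if either part has infinitely many classes, both sides are infinite. *)
have fin_sub n : has_iso_classes P n ->
    (exists n1, has_iso_classes P1 n1) /\ (exists n2, has_iso_classes P2 n2).
  move=> Pn; split; apply: has_iso_classes_sub Pn _ _.
  - by move=> K; rewrite PE; left.
  - by move=> K L P1K /PE[//|P2L] /(P12 _ _ P1K P2L).
  - by move=> K; rewrite PE; right.
  - by move=> K L P2K /PE[P1L|//] /field_iso_sym /(P12 _ _ P1L P2K).
have [[n1 H1]|N1] := pselect (exists n1, has_iso_classes P1 n1); last first.
  rewrite (iso_class_count_infinite N1) iso_class_count_infinite.
    by rewrite addye // /iso_class_count; case: pselect.
  by move=> [n /fin_sub[]].
have [[n2 H2]|N2] := pselect (exists n2, has_iso_classes P2 n2); last first.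
  rewrite (iso_class_count_infinite N2) iso_class_count_infinite.
    by rewrite addey // /iso_class_count; case: pselect.
  by move=> [n /fin_sub[]].
rewrite (iso_class_countE (has_iso_classes_add H1 H2 PE P12)).
by rewrite (iso_class_countE H1) (iso_class_countE H2) natrD EFinD.
Qed.

End Count.

Theorem theorem6 (R : realType) (d : int) (hd : fundamental_discriminant d)
    (hd3 : d <> -3) (X : R) (hX : 0 < X) :
  N_resolvent d X = (if (3 %| d)%Z then M3_shape (- (3 * d)) X + M3_shape (- (d %/ 3)%Z) X
           else M3_shape (- (3 * d)) X)%E.
Proof.
have disc_ex K : abs_disc_lt X K -> exists D, is_disc K D by move=> [D]; exists D.
case: ifPn => d3.
  apply: iso_class_count_add => [K|K L [K3 sK XK] [L3 sL XL] KL].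
    split=> [[K3 XK /(cubic_resolvent_shape hd K3 (disc_ex K XK))]|].
      by case=> [sK|[_ sK]]; [left | right].
    by case=> -[K3 sK XK]; split=> //; apply/(cubic_resolvent_shape hd K3 (disc_ex K XK));
      [left | right].
  (* Isomorphic fields in the two families would give - 3 d = - d / 3, hence d = 0. *)
  have := shape_disc_iso K3 L3 KL (disc_ex K XK) sK sL.
  have /eqP := fundamental_neq0 hd; have /dvdzP[f ->] := d3.
  by rewrite mulzK //; lia.
congr iso_class_count; apply/funext => K; apply/propext; split.
  move=> [K3 XK /(cubic_resolvent_shape hd K3 (disc_ex K XK))].
  by case=> [sK|[d3' _]]; [split | rewrite d3' in d3].
move=> [K3 sK XK]; split=> //; apply/(cubic_resolvent_shape hd K3 (disc_ex K XK)).
by left.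
Qed.
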